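(* Let $m$ be a positive even integer, let $n\in\mathbb{N}$, let $\boldsymbol{x}_1,\ldots,\boldsymbol{x}_n\in\Omega$ be pairwise distinct points, let $f\in\mathrm{C}(\Omega)$, and put $y_i:=f(\boldsymbol{x}_i)$ for $i=1,\ldots,n$ and $\boldsymbol{y}:=(y_1,\ldots,y_n)^T$. Then the multi-linear system $$\mathsf{A}_m\boldsymbol{c}^{m-1}=\boldsymbol{y}$$ has a unique solution $\boldsymbol{c}\in\mathbb{R}^n$, and with this $\boldsymbol{c}$ the function $$s_m(\boldsymbol{x}):=\mathsf{B}_m(\boldsymbol{x})\boldsymbol{c}^{m-1},\qquad \boldsymbol{x}\in\Omega,$$ satisfies $s_m(\boldsymbol{x}_1)=y_1,\ s_m(\boldsymbol{x}_2)=y_2,\ \ldots,\ s_m(\boldsymbol{x}_n)=y_n$.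
   Context: Standing setting: $\Omega\subseteq\mathbb{R}^d$ is a compact domain and $\Phi_2:\Omega\times\Omega\to\mathbb{R}$ is a continuous symmetric positive definite kernel, meaning that $\sum_{i,j=1}^{n}\Phi_2(\boldsymbol{x}_i,\boldsymbol{x}_j)c_ic_j>0$ for all $n\in\mathbb{N}$, all pairwise distinct $\boldsymbol{x}_1,\ldots,\boldsymbol{x}_n\in\Omega$ and all $\boldsymbol{c}\in\mathbb{R}^n\setminus\{0\}$. By Mercer's theorem, $$\Phi_2(\boldsymbol{z}_1,\boldsymbol{z}_2)=\sum_{k=1}^\infty\lambda_ke_k(\boldsymbol{z}_1)e_k(\boldsymbol{z}_2),\qquad \boldsymbol{z}_1,\boldsymbol{z}_2\in\Omega,$$ converging absolutely and uniformly, where $\lambda_k>0$ and $e_k$ are the (fixed) eigenvalues and continuous eigenfunctions of $\Phi_2$ (as an integral operator on $\mathrm{L}_2(\Omega)$). Put $\phi_k:=\lambda_k^{1/2}e_k$ and assume $\sum_{k=1}^\infty|\phi_k(\boldsymbol{x})|<\infty$ for all $\boldsymbol{x}\in\Omega$. For integers $m\ge2$ define $$\Phi_m(\boldsymbol{z}_1,\ldots,\boldsymbol{z}_m):=\sum_{k=1}^\infty\prod_{i=1}^m\phi_k(\boldsymbol{z}_i),\qquad \boldsymbol{z}_1,\ldots,\boldsymbol{z}_m\in\Omega,$$ which is well-defined (and agrees with $\Phi_2$ for $m=2$). Given pairwise distinct points $\boldsymbol{x}_1,\ldots,\boldsymbol{x}_n\in\Omega$ and $\boldsymbol{c}=(c_1,\ldots,c_n)^T\in\mathbb{R}^n$,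 put $\mathsf{A}_m:=(\Phi_m(\boldsymbol{x}_{i_1},\ldots,\boldsymbol{x}_{i_m}))_{i_1,\ldots,i_m=1}^{n,\ldots,n}$ and $\mathsf{B}_m(\boldsymbol{x}):=(\Phi_m(\boldsymbol{x},\boldsymbol{x}_{i_1},\ldots,\boldsymbol{x}_{i_{m-1}}))_{i_1,\ldots,i_{m-1}=1}^{n,\ldots,n}$ for $\boldsymbol{x}\in\Omega$, and $$\mathsf{A}_m\boldsymbol{c}^{m-1}:=\Big(\sum_{i_2,\ldots,i_m=1}^{n,\ldots,n}\Phi_m(\boldsymbol{x}_{i_1},\boldsymbol{x}_{i_2},\ldots,\boldsymbol{x}_{i_m})c_{i_2}\cdots c_{i_m}\Big)_{i_1=1}^n\in\mathbb{R}^n,$$ $$\mathsf{B}_m(\boldsymbol{x})\boldsymbol{c}^{m-1}:=\sum_{i_1,\ldots,i_{m-1}=1}^{n,\ldots,n}\Phi_m(\boldsymbol{x},\boldsymbol{x}_{i_1},\ldots,\boldsymbol{x}_{i_{m-1}})c_{i_1}\cdots c_{i_{m-1}}\in\mathbb{R}.$$ *)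

(* Defs.v *)
From HB Require Import structures.
From mathcomp Require Import all_boot all_order all_algebra.
From mathcomp Require Import all_classical all_reals all_analysis.

Set Implicit Arguments.
Unset Strict Implicit.
Unset Printing Implicit Defensive.

Import Order.TTheory GRing.Theory Num.Theory.
Import numFieldNormedType.Exports.

Local Open Scope classical_set_scope.
Local Open Scope ring_scope.

(* There is no measurable structure on 'rV[R]_d in the library, so the
   d-dimensional Lebesgue measure is built on d.-tuple R (whose sigma-algebra is
   the product of the Borel ones): it is the d-fold product of the
   one-dimensional Lebesgue measure, transported along (a, t) |-> a :: t. *)
Section lebesgue_measure_tuple.
Context (R : realType).
Local Notation RR := (measurableTypeR R).

Definition consT d (p : RR * d.-tuple RR) : d.+1.-tuple RR :=
  [tuple of p.1 :: p.2].

Lemma measurable_consT d : measurable_fun [set: RR * d.-tuple RR] (@consT d).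
Proof. exact: (measurable_cons measurable_fst measurable_snd). Qed.

Section step.
Variables (d : nat) (mu : {sigma_finite_measure set (d.-tuple RR) -> \bar R}).

Definition lebesgue_cons : set (d.+1.-tuple RR) -> \bar R :=
  pushforward (@lebesgue_measure R \x mu)%E (@consT d).

Let lebesgue_cons0 : lebesgue_cons set0 = 0%E.
Proof. by rewrite /lebesgue_cons /pushforward preimage_set0 measure0. Qed.

Let lebesgue_cons_ge0 A : (0 <= lebesgue_cons A)%E.
Proof. by rewrite /lebesgue_cons /pushforward measure_ge0. Qed.

Let lebesgue_cons_sigma_additive : semi_sigma_additive lebesgue_cons.
Proof.
have mpre A : measurable A -> measurable (@consT d @^-1` A).
  by move=> mA; rewrite -[X in measurable X]setTI; exact: measurable_consT.
move=> F mF tF mUF; rewrite /lebesgue_cons /pushforward preimage_bigcup.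
apply: measure_semi_sigma_additive => [n||]; first exact: mpre.
  apply/trivIsetP => i j _ _ ij; rewrite -preimage_setI.
  by move/trivIsetP : tF => /(_ _ _ I I ij) ->; rewrite preimage_set0.
by rewrite -preimage_bigcup; exact: mpre.
Qed.

HB.instance Definition _ := isMeasure.Build _ _ _ lebesgue_cons
  lebesgue_cons0 lebesgue_cons_ge0 lebesgue_cons_sigma_additive.

Lemma lebesgue_cons_sigma_finite : sigma_finite setT lebesgue_cons.
Proof.
have /sigma_finiteP [F [FT ndF Foo]] := sigma_finiteT (@lebesgue_measure R).
have /sigma_finiteP [G [GT ndG Goo]] := sigma_finiteT mu.
pose uncons (t : d.+1.-tuple RR) : RR * d.-tuple RR :=
  (thead t, [tuple of behead t]).
have consK p : uncons (consT p) = p.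
  by case: p => a t; congr pair; apply: val_inj.
have munc : measurable_fun setT uncons.
  apply/measurable_fun_pairP; split; last exact: measurable_behead.
  exact: (measurable_tnth ord0).
exists (fun i => uncons @^-1` (F i `*` G i)).
  apply/esym/seteqP; split=> // t _.
  have [i _ Fi] : (\bigcup_i F i) (uncons t).1 by rewrite -FT.
  have [j _ Gj] : (\bigcup_i G i) (uncons t).2 by rewrite -GT.
  exists (maxn i j) => //; split.
    by have /subsetPset/(_ _ Fi) := ndF _ _ (leq_maxl i j).
  by have /subsetPset/(_ _ Gj) := ndG _ _ (leq_maxr i j).
move=> i; have [mF Foo_] := Foo i; have [mG Goo_] := Goo i; split.
  by rewrite -[X in measurable X]setTI; apply: munc => //; exact: measurableX.
rewrite /lebesgue_cons /pushforward -comp_preimage.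
rewrite (_ : uncons \o @consT d = id); last exact/funext.
rewrite preimage_id product_measure1E//.
by rewrite lte_mul_pinfty// ge0_fin_numE.
Qed.

HB.instance Definition _ := @Measure_isSigmaFinite.Build _ _ _ lebesgue_cons
  lebesgue_cons_sigma_finite.

End step.

Fixpoint lebesgue_measure_tuple (d : nat) :
    {sigma_finite_measure set (d.-tuple RR) -> \bar R} :=
  match d with
  | 0 => dirac ([tuple] : 0.-tuple RR)
  | p.+1 => lebesgue_cons (lebesgue_measure_tuple p)
  end.

End lebesgue_measure_tuple.

Definition rV_of_tuple (R : realType) (d : nat)
    (t : d.-tuple (measurableTypeR R)) : 'rV[R]_d :=
  \row_i tnth t i.

Section kernels.
Context (R : realType) (d : nat).
Implicit Types (Omega : set 'rV[R]_d) (K : 'rV[R]_d -> 'rV[R]_d -> R).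

Definition symmetric_kernel Omega K :=
  forall z1 z2, Omega z1 -> Omega z2 -> K z1 z2 = K z2 z1.

Definition positive_definite_kernel Omega K :=
  forall (n : nat) (x : 'I_n -> 'rV[R]_d) (c : 'cV[R]_n),
    injective x -> (forall i, Omega (x i)) -> c != 0 ->
    0 < \sum_(i < n) \sum_(j < n) K (x i) (x j) * c i 0 * c j 0.

Definition integral_rV Omega (g : 'rV[R]_d -> R) : R :=
  \int[lebesgue_measure_tuple R d]_(t in @rV_of_tuple R d @^-1` Omega)
    g (rV_of_tuple t).

Definition ae_rV Omega (P : 'rV[R]_d -> Prop) : Prop :=
  {ae lebesgue_measure_tuple R d, forall t,
    Omega (rV_of_tuple t) -> P (rV_of_tuple t)}.

(* e is an eigenfunction, for the eigenvalue l, of the operator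
   g |-> int_Omega K(., u) g(u) du of L_2(Omega), so both its being nonzero and
   the eigenvalue equation are understood almost everywhere.  When Omega is
   compact, the continuity of e gives e \in L_2(Omega). *)
Definition continuous_eigenfunction Omega K (l : R) (e : 'rV[R]_d -> R) :=
  [/\ {within Omega, continuous e},
      ~ ae_rV Omega (fun z => e z = 0) &
      ae_rV Omega (fun z => integral_rV Omega (fun u => K z u * e u) = l * e z)].

(* Orthonormality of the e_k in L_2(Omega) is not required: only the expansion
   itself, its modes of convergence, and the eigenfunction equations are. *)
Definition mercer_expansion Omega K (l : nat -> R) (e : nat -> 'rV[R]_d -> R) :=
  (forall z1 z2, Omega z1 -> Omega z2 ->
     cvgn [normed series (fun k => l k * e k z1 * e k z2)]) /\
  {uniform Omega `*` Omega,
     (fun N (p : 'rV[R]_d * 'rV[R]_d) =>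
        series (fun k => l k * e k p.1 * e k p.2) N) @ \oo -->
     (fun p : 'rV[R]_d * 'rV[R]_d => K p.1 p.2)}.

Definition feature (l : nat -> R) (e : nat -> 'rV[R]_d -> R) (k : nat)
    (z : 'rV[R]_d) : R :=
  Num.sqrt (l k) * e k z.

(* Phi_m(z_1, ..., z_m); the order m is the length of the list of arguments *)
Definition multi_kernel (phi : nat -> 'rV[R]_d -> R) (z : seq 'rV[R]_d) : R :=
  limn (series (fun k => \prod_(u <- z) phi k u)).

End kernels.

(* An order-m tensor with all dimensions equal to n is a function on the
   multi-indices (i_1, ..., i_m). *)
Definition tensor (R : realType) (m n : nat) := m.-tuple 'I_n -> R.

Section tensors.
Context (R : realType) (m n : nat).

(* T c^(m-1) for T of order m > 0: the first index is free, the m-1 remaining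
   ones are contracted with c *)
Definition tensor_mulv (T : tensor R m n) (c : 'cV[R]_n) : 'cV[R]_n :=
  \col_i \sum_(t : m.-tuple 'I_n | ohead t == Some i)
    T t * \prod_(j <- behead t) c j 0.

(* T c^m for T of order m: all indices are contracted with c *)
Definition tensor_eval (T : tensor R m n) (c : 'cV[R]_n) : R :=
  \sum_(t : m.-tuple 'I_n) T t * \prod_(j <- t) c j 0.

End tensors.

Section interpolation.
Context (R : realType) (d : nat) (phi : nat -> 'rV[R]_d -> R).
Context (n : nat) (x : 'I_n -> 'rV[R]_d).

Definition tensorA (m : nat) : tensor R m n :=
  fun t => multi_kernel phi [seq x i | i <- t].

Definition tensorB (m : nat) (z : 'rV[R]_d) : tensor R m.-1 n :=
  fun t => multi_kernel phi (z :: [seq x i | i <- t]).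

Definition interpolant (m : nat) (c : 'cV[R]_n) (z : 'rV[R]_d) : R :=
  tensor_eval (@tensorB m z) c.

End interpolation.

Arguments tensorA {R d} phi {n} x m _.
Arguments tensorB {R d} phi {n} x m z _.
Arguments interpolant {R d} phi {n} x m c z.

(* Main.v *)
(* With u_k(c) = sum_i phi_k(x_i) c_i, expanding the tensor gives
   (A_m c^(m-1))_i = sum_k phi_k(x_i) u_k(c)^(m-1), which up to the factor m is
   the gradient of F(c) = sum_k u_k(c)^m.  Positive definiteness of Phi_2 says
   that no c != 0 annihilates all the u_k.  So for even m the m-homogeneous F is
   positive away from 0, F(c) - m <y, c> is coercive, and its minimiser solves
   the system: convexity of t |-> t^m replaces differentiating under the sum.
   Uniqueness is the strict monotonicity of t |-> t^(m-1).  Interpolation is the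
   system itself, read row by row. *)
Require Import Defs.
From HB Require Import structures.
From mathcomp Require Import all_boot all_order all_algebra.
From mathcomp Require Import all_classical all_reals all_analysis.
From mathcomp Require Import ring lra.

Set Implicit Arguments.
Unset Strict Implicit.
Unset Printing Implicit Defensive.

Import Order.TTheory GRing.Theory Num.Theory.
Import numFieldNormedType.Exports.

Local Open Scope classical_set_scope.
Local Open Scope ring_scope.

(** * Monotonicity of odd powers and convexity of even powers *)

Section powers.
Context {R : realDomainType}.
Implicit Types a b : R.

Lemma ltr_odd_exp a b q : odd q -> a < b -> a ^+ q < b ^+ q.
Proof.
move=> q_odd ab; have q0 : (0 < q)%N by case: q q_odd.
case: (lerP 0 a) => a0; first by rewrite ltrXn2r -?lt0n.
case: (ltrP 0 b) => b0.
  by apply: (@lt_trans _ _ 0); rewrite ?exprn_odd_lt0 ?exprn_odd_gt0.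
rewrite -ltrN2 -2?[- (_ ^+ q)]mulN1r -[-1](_ : (-1) ^+ q = _); last first.
  by rewrite -signr_odd q_odd expr1.
by rewrite -!exprMn !mulN1r ltrXn2r -?lt0n ?ltrN2 ?oppr_ge0.
Qed.

Lemma odd_exp_monotone a b q : odd q -> a != b ->
  0 < (a ^+ q - b ^+ q) * (a - b).
Proof.
move=> q_odd; rewrite neq_lt => /orP[] ab.
  by rewrite nmulr_rgt0 subr_lt0//; exact: ltr_odd_exp.
by rewrite mulr_gt0// subr_gt0//; exact: ltr_odd_exp.
Qed.

(** Weighted AM-GM by induction: the gap at [m.+1] is [b] times the gap at [m] plus a nonnegative
    multiple of [(a - b) ^+ 2]. *)
Lemma exp_tangent_ge0 a b m : 0 <= a -> 0 <= b ->
  m.+1%:R * (a ^+ m * b) <= m%:R * a ^+ m.+1 + b ^+ m.+1.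
Proof.
move=> a0 b0; elim: m => [|m IH]; first by rewrite !expr0 !expr1 !mul1r mul0r add0r.
have -> : m.+1%:R * a ^+ m.+2 + b ^+ m.+2 = m.+2%:R * (a ^+ m.+1 * b) +
  (b * (m%:R * a ^+ m.+1 + b ^+ m.+1 - m.+1%:R * (a ^+ m * b)) +
   m.+1%:R * a ^+ m * (a - b) ^+ 2).
  by rewrite -!natr1 !exprS; ring.
rewrite lerDl addr_ge0//; first by rewrite mulr_ge0// subr_ge0.
by rewrite mulr_ge0 ?exprn_even_ge0// mulr_ge0// exprn_ge0.
Qed.

(** The graph of an even power lies above its tangent at [a]. It suffices to treat [|a|] and [|b|]:
    even powers ignore signs, and [a ^+ m * b] is at most its absolute value. *)
Lemma even_exp_tangent a b m : ~~ odd m.+1 ->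
  a ^+ m.+1 - b ^+ m.+1 <= m.+1%:R * (a ^+ m * (a - b)).
Proof.
move=> m_even.
have := exp_tangent_ge0 m (normr_ge0 a) (normr_ge0 b).
have absX (c : R) : `|c| ^+ m.+1 = c ^+ m.+1.
  by rewrite -normrX ger0_norm ?exprn_even_ge0.
rewrite !absX -normrX -normrM => H.
have {}H := le_trans (ler_wpM2l (ler0n _ _) (ler_norm _)) H.
have S : m.+1%:R * a ^+ m.+1 = m%:R * a ^+ m.+1 + a ^+ m.+1.
  by rewrite -natr1 mulrDl mul1r.
rewrite mulrBr -exprSr mulrBr S; move: H.
move: (b ^+ m.+1) (a ^+ m.+1) (m%:R * _) (m.+1%:R * _) => B A Y X.
by lra.
Qed.

End powers.

(** * Minimisation of coercive homogeneous functions *)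

Section variational.
Context {R : realType}.

(** Stands in for the first-order condition at a minimum: the one-sided limits of [g] at 0 have
    opposite weak signs. *)
Lemma sign_change_root (g : R -> R) : {for 0, continuous g} ->
  (forall t, 0 <= t * g t) -> g 0 = 0.
Proof.
move=> g_cont g_sign; apply/eqP; rewrite eq_le; apply/andP; split.
- have : g t @[t --> 0^'-] --> g 0 by exact: cvg_at_left_filter.
  move=> /(@cvgr_to_le _ _ _ _ _ _ 0); apply.
  near=> t; have t0 : t < 0 by near: t; exact: nbhs_left_lt.
  by have := g_sign t; rewrite nmulr_rge0.
- have : g t @[t --> 0^'+] --> g 0 by exact: cvg_at_right_filter.
  move=> /(@cvgr_to_ge _ _ _ _ _ _ 0); apply.
  near=> t; have t0 : 0 < t by near: t; exact: nbhs_right_gt.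
  by have := g_sign t; rewrite pmulr_rge0.
Unshelve. all: by end_near. Qed.

Lemma continuous_min_box n (G : 'rV[R]_n -> R) (r : R) : 0 <= r ->
  continuous G ->
  exists2 c, `|c| <= r & forall b, `|b| <= r -> G c <= G b.
Proof.
move=> r0 G_cont.
(* The norm is the sup norm, so its closed ball is a product of segments, hence compact. *)
have normP (b : 'rV[R]_n) : `|b| <= r <-> forall i, b ord0 i \in `[- r, r].
  rewrite [`|b|]/Num.norm /= mx_normrE; split=> [br i|br].
    rewrite in_itv/= -ler_norml; apply: le_trans br.
    exact: (le_bigmax _ (fun i : 'I_1 * 'I_n => `|b i.1 i.2|) (ord0, i)).
  apply/bigmax_leP; split=> // -[i j] _ /=.
  by rewrite ler_norml ord1; have := br j; rewrite in_itv.
have box_compact : compact [set b : 'rV[R]_n | forall i, `[- r, r]%classic (b ord0 i)].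
  by apply: (@rV_compact _ _ (fun=> `[- r, r]%classic)) => i; exact: segment_compact.
have box0 : [set b : 'rV[R]_n | forall i, `[- r, r]%classic (b ord0 i)] !=set0.
  by exists 0 => i /=; rewrite mxE in_itv/= oppr_le0 r0.
have [c] := EVT_min_rV box0 box_compact (continuous_subspaceT G_cont).
rewrite inE => c_box c_min; exists c; first exact/normP.
by move=> b /normP b_box; apply: c_min; rewrite inE.
Qed.

(** [delta] is the minimum of [F] on the compact unit sphere; homogeneity carries the bound to every
    radius. *)
Lemma homogeneous_lower_bound n m (F : 'rV[R]_n -> R) :
  continuous F -> (forall s c, F (s *: c) = s ^+ m.+1 * F c) ->
  (forall c, c != 0 -> 0 < F c) ->
  exists2 delta, 0 < delta & forall c, delta * `|c| ^+ m.+1 <= F c.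
Proof.
move=> F_cont F_hom F_gt0.
have F0 : F 0 = 0 by rewrite -[0 in LHS](scale0r 0) F_hom expr0n mul0r.
suff [delta delta0 F_sphere] : exists2 delta, 0 < delta &
    forall c, `|c| = 1 -> delta <= F c.
  exists delta => // c; have [->|c0] := eqVneq c 0.
    by rewrite normr0 expr0n mulr0 F0.
  have nc : 0 < `|c| by rewrite normr_gt0.
  have -> : F c = F (`|c|^-1 *: c) * `|c| ^+ m.+1.
    by rewrite F_hom exprVn mulrAC mulVf ?mul1r// gt_eqF// exprn_gt0.
  rewrite ler_pM2r ?exprn_gt0//; apply: F_sphere.
  by rewrite normrZ normfV normr_id mulVf ?gt_eqF.
have S_compact : compact [set c : 'rV[R]_n | `|c| = 1].
  apply: bounded_closed_compact.
    by exists 1; split=> // M M1 c /= ->; exact: ltW.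
  have -> : [set c : 'rV[R]_n | `|c| = 1] = (fun c : 'rV[R]_n => `|c|) @^-1` [set 1] by [].
  by apply: closed_comp => [c _|]; [exact: norm_continuous|exact: closed_eq].
have [S0|S0] := pselect ([set c : 'rV[R]_n | `|c| = 1] !=set0).
  have [c] := EVT_min_rV S0 S_compact (continuous_subspaceT F_cont).
  rewrite inE /= => c1 c_min; exists (F c).
    by apply: F_gt0; rewrite -normr_eq0 c1 oner_neq0.
  by move=> b b1; apply: c_min; rewrite inE.
(* In dimension 0 the sphere is empty and any positive constant serves. *)
by exists 1 => // c c1; case: S0; exists c.
Qed.

Lemma coercive_min n m (F : 'rV[R]_n -> R) (y : 'rV[R]_n) :
  continuous F -> (forall s c, F (s *: c) = s ^+ m.+2 * F c) ->
  (forall c, c != 0 -> 0 < F c) ->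
  exists c, forall b,
    F c - \sum_i y 0 i * c 0 i <= F b - \sum_i y 0 i * b 0 i.
Proof.
move=> F_cont F_hom F_gt0.
have [delta delta0 F_ge] := homogeneous_lower_bound F_cont F_hom F_gt0.
pose G (c : 'rV[R]_n) := F c - \sum_i y 0 i * c 0 i.
have G_cont : continuous G.
  move=> c; apply: continuousB; first exact: F_cont.
  apply: (continuous_big add_continuous) => i _ {}c.
  by apply: continuousM; [exact: cst_continuous|exact: coord_continuous].
pose Y := \sum_i `|y 0 i|; have Y0 : 0 <= Y by exact: sumr_ge0.
have y_le (c : 'rV[R]_n) : \sum_i y 0 i * c 0 i <= Y * `|c|.
  rewrite mulr_suml; apply: ler_sum => i _.
  apply: le_trans (ler_norm _) _; rewrite normrM ler_wpM2l//.
  rewrite [X in _ <= X]/Num.norm /= mx_normrE.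
  exact: (le_bigmax _ (fun i : 'I_1 * 'I_n => `|c i.1 i.2|) (ord0, i)).
(* Outside this radius [|b| >= 1] and [delta * |b| >= Y]. As the degree is at least 2, [F b] then
   dominates the linear term, so [G b >= 0 = G 0]. *)
pose r := 1 + Y / delta.
have r1 : 1 <= r by rewrite lerDl divr_ge0// ltW.
have [c _ c_min] := continuous_min_box (le_trans ler01 r1) G_cont.
exists c => b; rewrite -/(G c) -/(G b); case: (lerP `|b| r) => [/c_min//|rb].
have G0 : G 0 = 0.
  rewrite /G -[X in F X](scale0r 0) F_hom expr0n mul0r big1 ?subr0// => i _.
  by rewrite mxE mulr0.
apply: (@le_trans _ _ 0); first by rewrite -G0 c_min// normr0 (le_trans ler01).
rewrite subr_ge0; apply: le_trans (y_le b) (le_trans _ (F_ge b)).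
have b1 : 1 <= `|b| by rewrite (le_trans r1)// ltW.
rewrite exprS mulrCA mulrC ler_wpM2l//.
apply: (@le_trans _ _ (delta * `|b|)).
  rewrite mulrC -ler_pdivrMr// (le_trans _ (ltW rb))//.
  by rewrite lerDr.
by rewrite ler_pM2l// exprS ler_peMr// exprn_ege1.
Qed.

(* [T c] is the gradient at [c] of the convex function
   [c |-> m.+2%:R^-1 * \sum_i T c i * c 0 i]. *)
Lemma homogeneous_gradient_surj n m (T : 'rV[R]_n -> 'I_n -> R) :
  let F c := \sum_i T c i * c 0 i in
  (forall i, continuous (T ^~ i)) ->
  (forall s c, F (s *: c) = s ^+ m.+2 * F c) ->
  (forall c, c != 0 -> 0 < F c) ->
  (forall c b, F c - F b <= m.+2%:R * \sum_i T c i * (c - b) 0 i) ->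
  forall y : 'I_n -> R, exists c, T c =1 y.
Proof.
move=> F T_cont F_hom F_gt0 F_tangent y.
have F_cont : continuous F.
  apply: (continuous_big add_continuous) => i _ c.
  by apply: continuousM; [exact: T_cont|exact: coord_continuous].
(* The target is scaled by [m.+2] to match the factor in the tangent inequality. *)
have [c c_min] := coercive_min (\row_i (m.+2%:R * y i)) F_cont F_hom F_gt0.
exists c => i; apply/eqP; rewrite -subr_eq0; apply/eqP.
pose b t : 'rV[R]_n := c + t *: delta_mx 0 i.
have b0 : b 0 = c by rewrite /b scale0r addr0.
(* The tangent is taken at the moved point [b t], not at [c]: minimality gives
   [m.+2 * t * y i <= F (b t) - F c], and the tangent inequality bounds this by
   [m.+2 * t * T (b t) i]. *)
rewrite -b0; apply: (@sign_change_root (fun t => T (b t) i - y i)).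
  apply: continuousB; last exact: cst_continuous.
  apply: (@continuous_comp _ _ _ b (T ^~ i)); last exact: T_cont.
  apply: continuousD; first exact: cst_continuous.
  exact: scalel_continuous.
move=> t.
have bE j : (b t - c) 0 j = t * (j == i)%:R.
  by rewrite /b addrAC subrr add0r !mxE eqxx.
have := le_trans _ (F_tangent (b t) c).
move=> /(_ (m.+2%:R * (t * y i))).
rewrite (bigD1 i)//= big1 => [|j ji]; last by rewrite bE (negbTE ji) !mulr0.
rewrite bE eqxx mulr1 addr0 ler_pM2l// => H.
rewrite mulrBr subr_ge0 [t * T _ _]mulrC; apply: H.
have E : \sum_j (\row_i (m.+2%:R * y i)) 0 j * (b t) 0 j =
    \sum_j (\row_i (m.+2%:R * y i)) 0 j * c 0 j + m.+2%:R * (t * y i).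
  apply/eqP; rewrite addrC -subr_eq -sumrB (bigD1 i)//= big1 => [|j ji].
    rewrite -mulrBr -[X in _ * X](_ : (b t - c) 0 i = _); last by rewrite !mxE.
    by rewrite bE eqxx mulr1 addr0 mxE mulrAC mulrA.
  rewrite -mulrBr -[X in _ * X](_ : (b t - c) 0 j = _); last by rewrite !mxE.
  by rewrite bE (negbTE ji) !mulr0.
have := c_min (b t); rewrite E; lra.
Qed.

End variational.

(** * Absolutely convergent series *)

Section absolute_series.
Context {R : realType}.
Implicit Types a b : R ^nat.

Lemma summable_bounded a : cvgn [normed series a] -> bounded_fun a.
Proof. by move=> /normed_cvg /cvg_series_bounded. Qed.

Lemma summable_mulr_bounded a b :
  cvgn [normed series a] -> bounded_fun b -> cvgn [normed series (a \* b)].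
Proof.
move=> a_sum [M [_ bM]].
(* [bounded_fun] provides bounds only strictly above [M]; this one is also nonnegative. *)
pose C := `|M| + 1.
have C0 : 0 <= C by rewrite addr_ge0.
have bC k : `|b k| <= C by apply: bM; rewrite // (le_lt_trans (ler_norm _))// ltrDl.
apply: (@series_le_cvg _ _ (C *: (fun k => `|a k|))).
- by move=> k; rewrite normr_ge0.
- by move=> k; exact: mulr_ge0.
- by move=> k /=; rewrite normrM mulrC ler_wpM2r.
- exact: is_cvg_seriesZ.
Qed.

Lemma bounded_funX b p : bounded_fun b -> bounded_fun (fun k => b k ^+ p).
Proof.
move=> [M [_ bM]]; exists ((`|M| + 1) ^+ p); split; first exact: num_real.
move=> y y_gt k _ /=; apply: le_trans (ltW y_gt); rewrite normrX lerXn2r//.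
  by rewrite nnegrE addr_ge0.
by apply: bM; rewrite // (le_lt_trans (ler_norm _))// ltrDl.
Qed.

Lemma summable_sum (I : finType) (w : I -> R ^nat) :
  (forall i, cvgn [normed series (w i)]) ->
  cvgn [normed series (fun k => \sum_i w i k)].
Proof.
move=> w_sum.
apply: (@series_le_cvg _ _ (fun k => \sum_i `|w i k|)).
- by move=> k; rewrite normr_ge0.
- by move=> k; exact: sumr_ge0.
- by move=> k; exact: ler_norm_sum.
have -> : series (fun k => \sum_i `|w i k|) =
    fun N => \sum_i series (fun k => `|w i k|) N.
  by apply/funext => N; rewrite /series /= exchange_big.
apply/cvg_ex; exists (\sum_i limn [normed series (w i)]).
by apply: cvg_big => [|i _]; [exact: add_continuous|exact: w_sum].
Qed.

Lemma lim_series_sum (I : finType) (h : I -> R) (w : I -> R ^nat) :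
  (forall i, cvgn (series (w i))) ->
  limn (series (fun k => \sum_i h i * w i k)) =
  \sum_i h i * limn (series (w i)).
Proof.
move=> w_cvg; apply: cvg_lim => //.
have -> : series (fun k => \sum_i h i * w i k) =
    fun N => \sum_i h i * series (w i) N.
  apply/funext => N; rewrite /series /= exchange_big/=.
  by apply: eq_bigr => i _; rewrite mulr_sumr.
by apply: cvg_big => [|i _]; [exact: add_continuous|apply: cvgM; [exact: cvg_cst|exact: w_cvg]].
Qed.

Lemma lim_series_gt0 a k : (forall j, 0 <= a j) -> cvgn (series a) ->
  0 < a k -> 0 < limn (series a).
Proof.
(* The partial sum of index [k.+1] is the first to contain the term [k]. *)
move=> a_ge0 a_cvg ak; apply: (@lt_le_trans _ _ (series a k.+1)).
  rewrite /series /= big_nat_recr//=; apply: ltr_wpDl => //.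
  exact: sumr_ge0.
by apply: nondecreasing_cvgn_le => //; exact: nondecreasing_series.
Qed.

End absolute_series.

(** * Contraction of tensors given by series of products *)

Section tensor_sums.
Context {R : realType} {I : finType}.

(** [E] lives on sequences so that [i :: t] can be passed to it without rebuilding a tuple. *)
Lemma big_cons_tuple p (E : seq I -> R) :
  \sum_(t : p.+1.-tuple I) E t = \sum_i \sum_(t : p.-tuple I) E (i :: t).
Proof.
rewrite pair_big /=.
rewrite (reindex (fun it : I * p.-tuple I => [tuple of it.1 :: it.2]))//=.
exists (fun t : p.+1.-tuple I => (thead t, [tuple of behead t])) => t _ /=.
  by case: t => i t; congr pair; apply: val_inj.
by rewrite -tuple_eta.
Qed.

Lemma summable_lin (v : nat -> I -> R) (c : I -> R) :
  (forall i, cvgn [normed series (v ^~ i)]) ->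
  cvgn [normed series (fun k => \sum_i v k i * c i)].
Proof.
move=> v_sum; apply: summable_sum => i.
by apply: (@summable_mulr_bounded _ (v ^~ i) (cst (c i))) => //; exact: bounded_cst.
Qed.

(** Expands the [p]-th power under the series, one index at a time. The weight [a] is general
    because each step of the induction absorbs a factor [v k i] into it; only finite sums are
    exchanged with the limit. *)
Lemma sum_tensor_power p (a : R ^nat) (v : nat -> I -> R) (c : I -> R) :
  cvgn [normed series a] -> (forall i, cvgn [normed series (v ^~ i)]) ->
  \sum_(t : p.-tuple I)
    limn (series (fun k => a k * \prod_(j <- t) v k j)) * \prod_(j <- t) c j =
  limn (series (fun k => a k * (\sum_i v k i * c i) ^+ p)).
Proof.
move=> + v_sum; elim: p a => [|p IH] a a_sum.
  rewrite (big_pred1 [tuple]) => [|t]; last exact/esym/eqP/tuple0.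
  rewrite /= big_nil mulr1; congr (limn (series _)).
  by apply/funext => k; rewrite big_nil expr0.
(* The new weights stay summable, a summable sequence being bounded. *)
have av_sum i := summable_mulr_bounded a_sum (summable_bounded (v_sum i)).
rewrite (big_cons_tuple _ (fun t => limn (series (fun k =>
  a k * \prod_(j <- t) v k j)) * \prod_(j <- t) c j)).
transitivity (\sum_i c i *
    limn (series (fun k => a k * v k i * (\sum_j v k j * c j) ^+ p))).
  apply: eq_bigr => i _; rewrite -(IH (a \* v ^~ i))// mulr_sumr.
  apply: eq_bigr => t _; rewrite big_cons mulrCA; congr (_ * (_ * _)); congr (limn (series _)).
  by apply/funext => k; rewrite big_cons mulrA.
rewrite -lim_series_sum => [|i].
  congr (limn (series _)); apply/funext => k.
  rewrite exprS mulr_suml mulr_sumr; apply: eq_bigr => i _.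
  by ring.
apply/normed_cvg/(summable_mulr_bounded (av_sum i))/bounded_funX.
exact/summable_bounded/summable_lin.
Qed.
End tensor_sums.

(** * Unique solvability of the interpolation system *)

Section interpolation_system.
Context {R : realType} {d n : nat} (phi : nat -> 'rV[R]_d -> R).
Context (x : 'I_n -> 'rV[R]_d).
Hypothesis phi_sum : forall i, cvgn [normed series (phi ^~ (x i))].

(** Only the multi-indices with head [i] survive, and their tails index the tensor of [interpolant].
    This makes each row of the system an interpolation condition. *)
Lemma tensor_mulv_interpolant m (c : 'cV[R]_n) i :
  tensor_mulv (tensorA phi x m.+1) c i 0 = interpolant phi x m.+1 c (x i).
Proof.
rewrite mxE big_mkcond /=.
rewrite (big_cons_tuple _ (fun t : seq 'I_n => if ohead t == Some i then
  multi_kernel phi [seq x j | j <- t] * \prod_(j <- behead t) c j 0 else 0)).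
rewrite (bigD1 i)//= [X in _ + X]big1 => [|j ji]; last first.
  by apply: big1 => t _; case: eqP => // -[ij]; rewrite ij eqxx in ji.
by rewrite addr0; apply: eq_bigr => t _; rewrite eqxx.
Qed.

(** Coefficients are rows from here on, hence the transposes: the minimisation above takes place in
    ['rV[R]_n]. *)
Let u (c : 'rV[R]_n) k := \sum_i phi k (x i) * c 0 i.

Lemma interpolantE m (c : 'rV[R]_n) i :
  interpolant phi x m.+1 c^T (x i) =
  limn (series (fun k => phi k (x i) * u c k ^+ m)).
Proof.
transitivity (limn (series (fun k =>
    phi k (x i) * (\sum_j phi k (x j) * c^T j 0) ^+ m))); last first.
  by congr (limn (series _)); apply/funext => k;
     under eq_bigr do rewrite mxE.
rewrite -(@sum_tensor_power _ _ m (phi ^~ (x i)) (fun k j => phi k (x j)))//.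
apply: eq_bigr => t _; congr (_ * _); congr (limn (series _)).
by apply/funext => k; rewrite big_cons big_map.
Qed.

Let u_summable c : cvgn [normed series (u c)].
Proof. exact: summable_lin. Qed.

Let phi_uX_cvg c m i : cvgn (series (fun k => phi k (x i) * u c k ^+ m)).
Proof.
apply/normed_cvg/(summable_mulr_bounded (@phi_sum i))/bounded_funX.
exact/summable_bounded/u_summable.
Qed.

(** Used with [h = c] for the homogeneous function itself, and with [h = c - b] for uniqueness and
    for the tangent inequality. *)
Lemma dot_interpolant m (c h : 'rV[R]_n) :
  \sum_i interpolant phi x m.+1 c^T (x i) * h 0 i =
  limn (series (fun k => u h k * u c k ^+ m)).
Proof.
rewrite (eq_bigr (fun i => h 0 i *
    limn (series (fun k => phi k (x i) * u c k ^+ m)))) => [|i _]; last first.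
  by rewrite interpolantE mulrC.
rewrite -lim_series_sum => [|i]; last exact: phi_uX_cvg.
congr (limn (series _)); apply/funext => k; rewrite mulr_suml.
by apply: eq_bigr => i _; rewrite mulrCA mulrA.
Qed.

Let u_uX_cvg (h c : 'rV[R]_n) m : cvgn (series (fun k => u h k * u c k ^+ m)).
Proof.
apply/normed_cvg/(summable_mulr_bounded (@u_summable h))/bounded_funX.
exact/summable_bounded/u_summable.
Qed.

(** The series enter only through the coefficients of a polynomial in the entries of [c]. *)
Lemma interpolant_continuous m z :
  continuous (fun c : 'rV[R]_n => interpolant phi x m c^T z).
Proof.
apply: (continuous_big add_continuous) => t _ c.
apply: continuousM; first exact: cst_continuous.
apply: (continuous_big mul_continuous) => j _ {}c.
under eq_fun do rewrite mxE; exact: coord_continuous.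
Qed.

Let uB c b k : u (c - b) k = u c k - u b k.
Proof. by rewrite -sumrB; apply: eq_bigr => i _; rewrite !mxE mulrBr. Qed.

Let uZ s c k : u (s *: c) k = s * u c k.
Proof. by rewrite mulr_sumr; apply: eq_bigr => i _; rewrite !mxE mulrCA. Qed.

Hypothesis u_neq0 : forall c, c != 0 -> exists k, u c k != 0.

Lemma interpolation_inj m (c b : 'rV[R]_n) : odd m ->
  (forall i, interpolant phi x m.+1 c^T (x i) =
             interpolant phi x m.+1 b^T (x i)) -> c = b.
Proof.
move=> m_odd cb; apply/eqP; rewrite -subr_eq0; apply/negPn/negP => /u_neq0[k uk].
(* The difference of the two systems paired with [c - b], term by term. Its sum is 0, yet all terms
   are nonnegative and the term [k] is positive. *)
pose w k := (u c k ^+ m - u b k ^+ m) * (u c k - u b k).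
have wE : w = (fun k => u (c - b) k * u c k ^+ m) \- (fun k => u (c - b) k * u b k ^+ m).
  by apply/funext => j; rewrite /w /= uB mulrBl ![_ ^+ m * _]mulrC.
have w_lim : limn (series w) = 0.
  rewrite wE lim_seriesB; [|exact: u_uX_cvg..]; rewrite -!dot_interpolant.
  by under eq_bigr do rewrite cb; rewrite subrr.
suff : 0 < limn (series w) by rewrite w_lim ltxx.
apply: (@lim_series_gt0 _ _ k).
- move=> j; rewrite /w; have [->|uj] := eqVneq (u c j) (u b j).
    by rewrite subrr mul0r.
  by rewrite ltW// odd_exp_monotone.
- by rewrite wE; apply: is_cvg_seriesB; exact: u_uX_cvg.
- by apply: odd_exp_monotone => //; rewrite -subr_eq0 -uB.
Qed.

Lemma interpolation_surj m (y : 'I_n -> R) : ~~ odd m ->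
  exists c : 'rV[R]_n, forall i, interpolant phi x m.+2 c^T (x i) = y i.
Proof.
move=> m_even.
pose T (c : 'rV[R]_n) i := interpolant phi x m.+2 c^T (x i).
pose F c := \sum_i T c i * c 0 i.
have FE c : F c = limn (series (fun k => u c k ^+ m.+2)).
  by rewrite /F dot_interpolant; congr (limn (series _)).
have uX_cvg c : cvgn (series (fun k => u c k ^+ m.+2)).
  by under eq_fun do rewrite exprS; exact: u_uX_cvg.
have [||||c Tc] := @homogeneous_gradient_surj _ n m T _ _ _ _ y; last by exists c.
- by move=> i; exact: interpolant_continuous.
- move=> s c; rewrite -/(F _) -/(F c) !FE -[RHS](lim_seriesZ _ (uX_cvg c)).
  by congr (limn (series _)); apply/funext => k; rewrite uZ exprMn.
- move=> c /u_neq0[k uk]; rewrite -/(F c) FE; apply: (@lim_series_gt0 _ _ k) => //.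
    by move=> j; rewrite exprn_even_ge0//= negbK.
  by rewrite exprn_even_gt0//= negbK.
- move=> c b; rewrite -/(F c) -/(F b) dot_interpolant !FE.
  rewrite -lim_seriesB// -[X in _ <= X](lim_seriesZ _ (@u_uX_cvg (c - b) c m.+1)).
  (* The tangent inequality is applied to each [u c k] and [u b k], then summed over [k]. *)
  apply: lim_series_le.
  + exact: is_cvg_seriesB.
  + by apply: is_cvg_seriesZ; exact: u_uX_cvg.
  + move=> k; have -> : (m.+2%:R *: (fun k => u (c - b) k * u c k ^+ m.+1)) k =
      m.+2%:R * (u c k ^+ m.+1 * (u c k - u b k)) by rewrite -uB [u c k ^+ _ * _]mulrC.
    by apply: even_exp_tangent; rewrite /= negbK.
Qed.

End interpolation_system.

(** * From positive definiteness to nonvanishing feature combinations *)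

(** By the expansion of [K], its quadratic form at [c] is the sum over [k] of the squares of these
    combinations. If all of them vanished, so would the form. *)
Lemma feature_span_neq0 (R : realType) (d n : nat) (Omega : set 'rV[R]_d)
    (K : 'rV[R]_d -> 'rV[R]_d -> R) (l : nat -> R) (e : nat -> 'rV[R]_d -> R)
    (x : 'I_n -> 'rV[R]_d) (c : 'rV[R]_n) :
  (forall k, 0 < l k) -> positive_definite_kernel Omega K ->
  mercer_expansion Omega K l e -> injective x -> (forall i, Omega (x i)) ->
  c != 0 -> exists k, \sum_i feature l e k (x i) * c 0 i != 0.
Proof.
move=> l_gt0 K_pd [_ K_unif] x_inj x_Omega c0.
apply: contrapT => /forallNP u0.
have {}u0 k : \sum_i feature l e k (x i) * c 0 i = 0.
  by apply/eqP/negPn/negP/u0.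
have K_cvg i j :
    series (fun k => l k * e k (x i) * e k (x j)) @ \oo --> K (x i) (x j).
  have ij : [set (x i, x j)] `<=` Omega `*` Omega by move=> _ ->; split=> /=.
  (* Uniform convergence restricted to a single point is pointwise convergence. *)
  have := @uniform_subset_cvg _ _ _ _ _ _ _ ij K_unif.
  by rewrite uniform_set1; exact.
have cT0 : c^T != 0 by rewrite trmx_eq0.
have := K_pd n x c^T x_inj x_Omega cT0.
suff -> : \sum_i \sum_j K (x i) (x j) * c^T i 0 * c^T j 0 = 0 by rewrite ltxx.
have lhs_cvg : \sum_i \sum_j series (fun k => l k * e k (x i) * e k (x j)) N *
    c^T i 0 * c^T j 0 @[N --> \oo] -->
    \sum_i \sum_j K (x i) (x j) * c^T i 0 * c^T j 0.
  apply: cvg_big => [|i _]; first exact: add_continuous.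
  apply: cvg_big => [|j _]; first exact: add_continuous.
  apply: cvgM; last exact: cvg_cst.
  by apply: cvgM; [exact: K_cvg|exact: cvg_cst].
apply: (cvg_unique _ lhs_cvg) => //.
rewrite [X in X @ _](_ : _ = cst 0); first exact: cvg_cst.
apply/funext => N; rewrite /=.
(* Since [l k] is the square of its root, each summand in [k] is a perfect square. *)
transitivity (\sum_(0 <= k < N) (\sum_i feature l e k (x i) * c 0 i) ^+ 2).
  under eq_bigr do (under eq_bigr do rewrite /series /= 2!mulr_suml;
    rewrite exchange_big /=).
  rewrite exchange_big /=; apply: eq_bigr => k _.
  rewrite expr2 mulr_suml; apply: eq_bigr => i _.
  rewrite mulr_sumr; apply: eq_bigr => j _; rewrite !mxE /feature.
  rewrite -{1}(sqr_sqrtr (ltW (l_gt0 k))); ring.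
by apply: big1 => k _; rewrite u0 expr0n.
Qed.

(** * Interpolation with kernels of even order *)

Unset Implicit Arguments.

Theorem theorem4p1 (R : realType) (d : nat) (Omega : set 'rV[R]_d)
    (Phi2 : 'rV[R]_d -> 'rV[R]_d -> R)
    (lambda : nat -> R) (e : nat -> 'rV[R]_d -> R)
    (Omega_compact : compact Omega)
    (Phi2_continuous : {within Omega `*` Omega,
       continuous (fun p : 'rV[R]_d * 'rV[R]_d => Phi2 p.1 p.2)})
    (Phi2_symmetric : symmetric_kernel Omega Phi2)
    (Phi2_pd : positive_definite_kernel Omega Phi2)
    (lambda_gt0 : forall k, 0 < lambda k)
    (e_eigen : forall k, continuous_eigenfunction Omega Phi2 (lambda k) (e k))
    (Phi2_mercer : mercer_expansion Omega Phi2 lambda e)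
    (feature_summable : forall z, Omega z ->
       cvgn [normed series (fun k => feature lambda e k z)])
    (m : nat) (m_gt0 : (0 < m)%N) (m_even : ~~ odd m)
    (n : nat) (x : 'I_n -> 'rV[R]_d)
    (x_inj : injective x) (x_Omega : forall i, Omega (x i))
    (f : 'rV[R]_d -> R) (f_continuous : {within Omega, continuous f}) :
  let phi := feature lambda e in
  let y : 'cV[R]_n := \col_i f (x i) in
  exists c : 'cV[R]_n,
    unique (fun c' : 'cV[R]_n => tensor_mulv (tensorA phi x m) c' = y) c /\
    (forall i, interpolant phi x m c (x i) = y i 0).
Proof.
move=> phi y.
have phi_sum i : cvgn [normed series (phi ^~ (x i))] by exact: feature_summable.
have u_neq0 (c : 'rV[R]_n) : c != 0 -> exists k, \sum_i phi k (x i) * c 0 i != 0.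
  exact: (feature_span_neq0 lambda_gt0 Phi2_pd Phi2_mercer x_inj x_Omega).
(* A positive even order has the form [m.+2] with [m] even, so the power [m.+1] in the system is
   odd. *)
case: m m_gt0 m_even => [//|[//|m]] _; rewrite /= negbK => m_even.
have [c cy] := interpolation_surj phi_sum u_neq0 (fun i => y i 0) m_even.
exists c^T; split=> //; split=> [|b by_].
  by apply/colP => i; rewrite tensor_mulv_interpolant cy.
apply: trmx_inj; rewrite trmxK.
apply: (interpolation_inj phi_sum u_neq0 (m := m.+1)) => // i.
by rewrite cy trmxK -tensor_mulv_interpolant by_.
Qed.
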